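(* Let $0<r<1$ and $1<p<\infty$. Then the space $t_p^r$ has Banach-Saks type $p$.
   Context: Let $\mathbb{N}=\{0,1,2,\dots\}$ and let $\omega$ be the linear space of all (real or complex) sequences $x=(x_k)_{k\in\mathbb{N}}$. For $0<r<1$ the Taylor transform $T(r)x$ of $x\in\omega$ is the sequence with terms $$(T(r)x)_n=\sum_{k=n}^{\infty}\binom{k}{n}(1-r)^{n+1}r^{k-n}x_k\qquad(n\in\mathbb{N}),$$ whenever all these series converge. For $1\le p<\infty$ let $$t_p^r=\Big\{x\in\omega:\ \sum_{n}\Big|\sum_{k=n}^{\infty}\binom{k}{n}(1-r)^{n+1}r^{k-n}x_k\Big|^p<\infty\Big\},$$ equipped with the norm $\|x\|_{t_p^r}=\|T(r)x\|_{\ell_p}$. For $1<p<\infty$, a Banach space is said to have the Banach-Saks type $p$ if every weakly null sequence has a subsequence $(x_k)$ such that for some $C>0$, $$\Big\|\sum_{k=0}^{n}x_k\Big\|<C(n+1)^{1/p}\qquad\text{for all } n\in\mathbb{N}.$$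
   Formalization: The norm ‖T(r)x‖_{ℓ_p} is only a seminorm on t_p^r, since T(r) has a nontrivial kernel, so t_p^r is not literally a Banach space; the Banach-Saks type p property is stated and proved for this seminorm, and completeness is not claimed. *)

(* Defs.v *)
From HB Require Import structures.
From mathcomp Require Import all_boot all_order all_algebra.
From mathcomp Require Import all_classical all_reals all_analysis.
From mathcomp Require Import complex.

Set Implicit Arguments.
Unset Strict Implicit.
Unset Printing Implicit Defensive.

Import Order.TTheory GRing.Theory Num.Theory.
Import numFieldNormedType.Exports.

Local Open Scope classical_set_scope.
Local Open Scope ring_scope.

(** The library norm of a [numFieldType] takes its values in the field itself,
    so over [R[i]] it is not an element of [R]. A [scalarField R] packages a
    field with its embedding of [R] and its [R]-valued modulus; the two
    instances below, [R] and [R[i]], are the intended ones. *)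
Record scalarField (R : realType) := ScalarField {
  scalar_sort :> numFieldType;
  of_real : {rmorphism R -> scalar_sort};
  modulus : scalar_sort -> R;
  ler_of_real : {mono of_real : x y / x <= y};
  modulusE : forall z, of_real (modulus z) = `|z| }.

Arguments of_real {R} s.
Arguments modulus {R s} z.

Section ScalarInstances.
Variable R : realType.

Definition real_field : scalarField R :=
  @ScalarField R R idfun (fun z => `|z|) (fun _ _ => erefl) (fun _ => erefl).

Lemma normc_modulusE (z : R[i]) :
  real_complex R (ComplexField.Normc.normc z) = `|z|.
Proof. by case: z. Qed.

Definition complex_field : scalarField R :=
  @ScalarField R R[i] (real_complex R) (@ComplexField.Normc.normc R)
    (@lecR R) normc_modulusE.

End ScalarInstances.

Section Modulus.
Variables (R : realType) (K : scalarField R).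
Implicit Types z w : K.

Lemma modulus_ge0 z : 0 <= modulus z.
Proof. by rewrite -(ler_of_real K) rmorph0 modulusE. Qed.

Lemma modulusD z w : modulus (z + w) <= modulus z + modulus w.
Proof. by rewrite -(ler_of_real K) rmorphD !modulusE ler_normD. Qed.

Lemma modulusM z w : modulus (z * w) = modulus z * modulus w.
Proof.
by apply: (fmorph_inj (of_real K)); rewrite rmorphM !modulusE normrM.
Qed.

Lemma modulus0 : modulus (0 : K) = 0.
Proof. by apply: (fmorph_inj (of_real K)); rewrite modulusE normr0 rmorph0. Qed.

End Modulus.

Record seminorm (R : realType) (K : scalarField R) (V : lmodType K) := Seminorm {
  seminorm_fun :> V -> R;
  seminormD : forall x y, seminorm_fun (x + y) <= seminorm_fun x + seminorm_fun y;
  seminormZ : forall a x, seminorm_fun (a *: x) = modulus a * seminorm_fun x }.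

Section SeminormedSpaces.
Variables (R : realType) (K : scalarField R) (V : lmodType K).
Variable N : seminorm V.

Definition continuous_functional (f : V -> K) : Prop :=
  forall (x : V) (e : R), 0 < e ->
    exists2 d : R, 0 < d & forall y, N (y - x) < d -> modulus (f y - f x) < e.

Definition weakly_null (x : nat -> V) : Prop :=
  forall f : {linear V -> K}, continuous_functional f ->
    f (x j) @[j --> \oo] --> (0 : K).

Definition Banach_Saks_type (p : R) : Prop :=
  forall x : nat -> V, weakly_null x ->
    exists2 s : nat -> nat, {homo s : i j / (i < j)%N} &
      exists2 C : R, 0 < C &
        forall n, N (\sum_(0 <= k < n.+1) x (s k)) < C * n.+1%:R `^ p^-1.

End SeminormedSpaces.

Section TaylorTransform.
Variables (R : realType) (K : scalarField R) (r : R).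
Implicit Types (x y : nat -> K) (n m : nat).

Definition taylor_coef n k : R :=
  'C(k, n)%:R * (1 - r) ^+ n.+1 * r ^+ (k - n).

Definition taylor_partial x n m : K :=
  \sum_(n <= k < m) of_real K (taylor_coef n k) * x k.

Definition taylor_transform x n : K := limn (taylor_partial x n).

Definition taylor_power_sum (p : R) x : \bar R :=
  (\sum_(n <oo) (modulus (taylor_transform x n) `^ p)%:E)%E.

Definition in_taylor_space (p : R) x : Prop :=
  (forall n, cvgn (taylor_partial x n)) /\ (taylor_power_sum p x < +oo)%E.

Definition taylor_space_pred (p : R) : {pred nat -> K} :=
  fun x => `[< in_taylor_space p x >].

Lemma taylor_partialD x y n :
  taylor_partial (x + y) n = taylor_partial x n + taylor_partial y n.
Proof.
apply/funext => m; rewrite [LHS](eq_bigr _ (fun k _ => mulrDr _ _ _)).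
exact: big_split.
Qed.

Lemma taylor_partialZ (a : K) x n :
  taylor_partial (a *: x) n = (fun=> a) \* taylor_partial x n.
Proof.
apply/funext => m; rewrite /taylor_partial/= mulr_sumr.
by apply: eq_bigr => k _; rewrite mulrCA.
Qed.

Lemma taylor_transformD x y n :
  cvgn (taylor_partial x n) -> cvgn (taylor_partial y n) ->
  taylor_transform (x + y) n = taylor_transform x n + taylor_transform y n.
Proof. by move=> cx cy; rewrite /taylor_transform taylor_partialD limD. Qed.

Lemma is_cvg_taylor_partialZ (a : K) x n :
  cvgn (taylor_partial x n) -> cvgn (taylor_partial (a *: x) n).
Proof. by move=> cx; rewrite taylor_partialZ; apply: is_cvgMl_tmp. Qed.

Lemma taylor_transformZ (a : K) x n : cvgn (taylor_partial x n) ->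
  taylor_transform (a *: x) n = a * taylor_transform x n.
Proof.
move=> cx; rewrite /taylor_transform taylor_partialZ limM//; last exact: is_cvg_cst.
by rewrite lim_cst.
Qed.

Section Subspace.
Variable p : R.
Hypothesis p_ge1 : 1 <= p.
Let p_gt0 : 0 < p. Proof. exact: lt_le_trans p_ge1. Qed.
Let pV_ge0 : 0 <= p^-1. Proof. by rewrite invr_ge0 ltW. Qed.

Let term_ge0 x n : (0 <= (modulus (taylor_transform x n) `^ p)%:E)%E.
Proof. by rewrite lee_fin powR_ge0. Qed.

Let psum_ge0 x : (0 <= taylor_power_sum p x)%E.
Proof. exact: nneseries_ge0. Qed.

Let minkowski_series (u v : nat -> R) :
  ((\sum_(n <oo) (`|u n + v n| `^ p)%:E) `^ p^-1 <=
   (\sum_(n <oo) (`|u n| `^ p)%:E) `^ p^-1 +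
   (\sum_(n <oo) (`|v n| `^ p)%:E) `^ p^-1)%E.
Proof.
have mf (w : nat -> R) : measurable_fun setT w by [].
have := minkowski_EFin counting (mf u) (mf v) p_ge1.
by rewrite !(Lnorm_counting _ p_gt0).
Qed.

Lemma taylor_power_sum_rootD x y :
  in_taylor_space p x -> in_taylor_space p y ->
  (taylor_power_sum p (x + y)%R `^ p^-1 <=
   taylor_power_sum p x `^ p^-1 + taylor_power_sum p y `^ p^-1)%E.
Proof.
move=> [cx _] [cy _]; pose u z n := modulus (taylor_transform z n).
have uE z : taylor_power_sum p z = (\sum_(n <oo) (`|u z n| `^ p)%:E)%E.
  by apply: eq_eseriesr => n _; rewrite ger0_norm// modulus_ge0.
rewrite (uE x) (uE y).
apply: le_trans (minkowski_series (u x) (u y)).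
have sum_ge0 : (0 <= \sum_(n <oo) (`|u x n + u y n| `^ p)%:E)%E.
  by apply: nneseries_ge0 => n _ _; rewrite lee_fin powR_ge0.
apply: (gt0_ler_poweR pV_ge0).
- by rewrite in_itv/= psum_ge0 leey.
- by rewrite in_itv/= sum_ge0 leey.
apply: lee_nneseries => [n _ _|n _]; first exact: term_ge0.
rewrite lee_fin; apply: ge0_ler_powR.
- exact: ltW.
- by rewrite nnegrE modulus_ge0.
- by rewrite nnegrE normr_ge0.
rewrite taylor_transformD//; apply: le_trans (modulusD _ _) _.
exact: ler_norm.
Qed.

Lemma taylor_power_sumZ (a : K) x : in_taylor_space p x ->
  taylor_power_sum p (a *: x) = ((modulus a `^ p)%:E * taylor_power_sum p x)%E.
Proof.
move=> [cx _]; rewrite /taylor_power_sum -nneseriesZl//.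
apply: eq_eseriesr => n _; rewrite taylor_transformZ// modulusM.
by rewrite powRM ?modulus_ge0.
Qed.

Lemma taylor_space_submod_closed : submod_closed (taylor_space_pred p).
Proof.
have clZ a x : in_taylor_space p x -> in_taylor_space p (a *: x).
  move=> tx; have [cx sx] := tx; split.
    by move=> n; exact: is_cvg_taylor_partialZ.
  by rewrite taylor_power_sumZ// lte_mul_pinfty// lee_fin powR_ge0.
split.
  apply/asboolP.
  have p0 n : taylor_partial 0 n = cst 0.
    by apply/funext => m; rewrite /taylor_partial big1// => k _; rewrite mulr0.
  split=> [n|]; first by rewrite p0; exact: is_cvg_cst.
  rewrite /taylor_power_sum eseries0// => n _ _.
  by rewrite /taylor_transform p0 lim_cst// modulus0 powR0// gt_eqF.
move=> a x y /asboolP tx /asboolP ty; apply/asboolP.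
have tax := clZ a _ tx; have [cax sax] := tax; have [cy sy] := ty; split.
  by move=> n; rewrite taylor_partialD; exact: is_cvgD.
apply: (@lty_poweRy _ _ p^-1); first by rewrite invr_eq0 gt_eqF.
apply: le_lt_trans (taylor_power_sum_rootD tax ty) _.
by rewrite lte_add_pinfty// poweR_lty.
Qed.

HB.instance Definition _ := GRing.isSubmodClosed.Build K (nat -> K)
  (taylor_space_pred p) taylor_space_submod_closed.

Definition taylor_space & 1 <= p : Type :=
  {x : nat -> K | x \in taylor_space_pred p}.
Local Notation tspace := (taylor_space p_ge1).

HB.instance Definition _ := [isSub of tspace for @sval _ _].
HB.instance Definition _ := [Choice of tspace by <:].
HB.instance Definition _ := [SubChoice_isSubLmodule of tspace by <:].

Definition taylor_norm_fun (x : tspace) : R :=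
  fine (taylor_power_sum p (val x)) `^ p^-1.

Lemma in_taylor_space_val (x : tspace) : in_taylor_space p (val x).
Proof. exact/asboolP/(valP x). Qed.

Let norm_funE (x : tspace) :
  (taylor_norm_fun x)%:E = (taylor_power_sum p (val x) `^ p^-1)%E.
Proof.
have [_ sx] := in_taylor_space_val x.
by rewrite /taylor_norm_fun -poweR_EFin fineK// ge0_fin_numE.
Qed.

Lemma taylor_norm_funD (x y : tspace) :
  taylor_norm_fun (x + y) <= taylor_norm_fun x + taylor_norm_fun y.
Proof.
have leD (a b c : R) (u v w : \bar R) :
    a%:E = u -> b%:E = v -> c%:E = w -> (w <= u + v)%E -> c <= a + b.
  by move=> <- <- <-; rewrite -EFinD lee_fin.
have E : val (x + y) = (val x + val y : nat -> K) by [].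
have := taylor_power_sum_rootD (in_taylor_space_val x) (in_taylor_space_val y).
rewrite -E.
exact: leD (norm_funE x) (norm_funE y) (norm_funE (x + y)).
Qed.

Lemma taylor_norm_funZ (a : K) (x : tspace) :
  taylor_norm_fun (a *: x) = modulus a * taylor_norm_fun x.
Proof.
have xP := in_taylor_space_val x.
rewrite /taylor_norm_fun.
have -> : val (a *: x) = a *: (val x : nat -> K) by [].
rewrite (taylor_power_sumZ a xP); have [_ sx] := xP.
rewrite fineM//; last by rewrite ge0_fin_numE.
rewrite powRM ?powR_ge0 ?fine_ge0// -powRrM mulfV ?gt_eqF// powRr1//.
exact: modulus_ge0.
Qed.

(** Only a seminorm: for [0 < r < 1] the transform has a nontrivial kernel. If
    [x] is the sequence of Taylor coefficients at [0] of
    [z |-> exp (- (1 - z / r) ^ (- 1/2))], which is smooth on the closed disc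
    [`|z| <= r] and flat at [z = r], then all the series converge to [0].
    [taylor_norm] is a norm modulo this kernel, and the dual space, weak
    convergence and [Banach_Saks_type] are insensitive to that quotient. *)
Definition taylor_norm : seminorm tspace :=
  Seminorm taylor_norm_funD taylor_norm_funZ.

End Subspace.
End TaylorTransform.

Arguments taylor_space {R} K r {p} p_ge1.
Arguments taylor_norm {R} K r {p} p_ge1.

(* Main.v *)
Require Import Defs.
From HB Require Import structures.
From mathcomp Require Import all_boot all_order all_algebra.
From mathcomp Require Import all_classical all_reals all_analysis.
From mathcomp Require Import complex lra ring.

(** The Taylor transform [T] embeds the Taylor space isometrically (up to the
    kernel of the seminorm) into the space of [p]-summable sequences, and the
    Banach-Saks type [p] is inherited from there. The argument only uses the
    coordinates [T n] as linear functionals, and the fact that the [p]-th power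
    of the norm is the least upper bound of the partial sums of the
    [modulus (T n v) `^ p].

    Let [x] be weakly null. Two facts are needed.

    Boundedness ([weakly_null_bounded]). The usual proof applies the uniform
    boundedness principle in the dual. Here an explicit functional is built
    instead, in the manner of Sokal's proof of that principle: if the norms of
    the [x j] were unbounded, pick terms [z n] with norm at least [8 * 9 ^+ n],
    functionals [g n] of norm at most 1 that almost norm them
    ([norming_functional]), and set [F 0 = 0] and [F n.+1 = F n] or
    [F n + 9^-1 ^+ n * g n], so as to be large at [z n]. The steps shrink so
    fast that the limit functional is still at least 1 at every [z n], so that
    [x] is not weakly null. The limit exists because absolutely convergent
    series converge in both scalar fields.

    Asymptotic disjointness ([near_powR_seminormD_le]). The coordinates of [x j]
    tend to 0, so for a fixed vector [v] the vector [x j] eventually lives,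
    up to a small error, where [v] is negligible. Hence
    [N (v + x j) `^ p <= N v `^ p + M `^ p + e] for [j] large, where [M] bounds
    the norms.

    Choosing each term of the subsequence after the sum [v] of the earlier ones,
    with [e = 1], adds at most [M `^ p + 1] to the [p]-th power of the norm at
    each step, and this is the required growth of order [n.+1 `^ p^-1]. *)

Set Implicit Arguments.
Unset Strict Implicit.
Unset Printing Implicit Defensive.

Import Order.TTheory GRing.Theory Num.Theory.
Import numFieldNormedType.Exports.

Local Open Scope classical_set_scope.
Local Open Scope ring_scope.

(** * Inequalities for finite sums of powers *)

Lemma powR_div (R : realType) (p x y : R) : 0 <= x -> 0 < y ->
  (x / y) `^ p = x `^ p / y `^ p.
Proof.
move=> x0 y0; rewrite powRM ?invr_ge0 ?(ltW y0)//.
by rewrite -(powR_inv1 (ltW y0)) -powRrM mulN1r powRN.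
Qed.

(** Convexity of [powR ^~ p], with [(a + b) / (A + B)] seen as the average of
    [a / A] and [b / B] of weights [A / (A + B)] and [B / (A + B)]. *)
Lemma powR_convex_div (R : realType) (p a b A B : R) : 1 <= p ->
  0 <= a -> 0 <= b -> 0 < A -> 0 < B ->
  ((a + b) / (A + B)) `^ p <=
    A / (A + B) * (a / A) `^ p + B / (A + B) * (b / B) `^ p.
Proof.
move=> p1 a0 b0 A0 B0; have AB0 : 0 < A + B by rewrite addr_gt0.
have t0 : 0 <= A / (A + B) by rewrite divr_ge0 ?ltW.
have t1 : A / (A + B) <= 1 by rewrite ler_pdivrMr// mul1r lerDl ltW.
have := @convex_powR R p p1 (Itv01 t0 t1) (a / A) (b / B).
rewrite !inE/= !in_itv/= !andbT !divr_ge0 ?(ltW A0) ?(ltW B0)// => /(_ isT isT).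
rewrite [X in X `^ p <= _ -> _]convRE [X in _ <= X -> _]convRE /=.
rewrite /unstable.onem.
have -> : 1 - A / (A + B) = B / (A + B) by field; rewrite gt_eqF.
have -> : A / (A + B) * (a / A) + B / (A + B) * (b / B) = (a + b) / (A + B).
  by field; rewrite !gt_eqF.
exact.
Qed.

(** Minkowski's inequality with upper bounds [A] and [B] in place of the norms:
    then it is the sum over [i] of [powR_convex_div], and dividing by the
    positive bounds makes sense even when a norm vanishes. *)
Lemma minkowski_sum (R : realType) (I : Type) (s : seq I) (p A B : R)
    (a b : I -> R) : 1 <= p -> 0 < A -> 0 < B ->
  (forall i, 0 <= a i) -> (forall i, 0 <= b i) ->
  \sum_(i <- s) a i `^ p <= A `^ p -> \sum_(i <- s) b i `^ p <= B `^ p ->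
  \sum_(i <- s) (a i + b i) `^ p <= (A + B) `^ p.
Proof.
move=> p1 A0 B0 a0 b0 sa sb; have AB0 : 0 < A + B by rewrite addr_gt0.
rewrite -[leRHS]mul1r -ler_pdivrMr ?powR_gt0// mulr_suml.
have le1 : \sum_(i <- s) (A / (A + B) * (a i / A) `^ p +
    B / (A + B) * (b i / B) `^ p) <= 1.
  rewrite big_split/= -!mulr_sumr.
  have sum_div (x : I -> R) X : (forall i, 0 <= x i) -> 0 < X ->
      \sum_(i <- s) (x i / X) `^ p = (\sum_(i <- s) x i `^ p) / X `^ p.
    by move=> x0 X0; rewrite mulr_suml; apply: eq_bigr => i _; rewrite powR_div.
  rewrite !sum_div//.
  have -> : 1 = A / (A + B) * 1 + B / (A + B) * 1.
    by rewrite !mulr1 -mulrDl mulfV// gt_eqF.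
  by apply: lerD; rewrite ler_wpM2l ?divr_ge0 ?(ltW A0) ?(ltW B0) ?(ltW AB0)//
    ler_pdivrMr ?powR_gt0// mul1r.
apply: le_trans le1; apply: ler_sum => i _.
by rewrite -powR_div ?addr_ge0//; exact: powR_convex_div.
Qed.

(** Hoelder's inequality for the exponents [p / (p - 1)] and [p], in the form
    that the norming functional of a vector calls for. It is the sum over [i] of
    Young's inequality for [(a i / A) `^ (p - 1)] and [b i / B]. *)
Lemma hoelder_sum (R : realType) (I : Type) (s : seq I) (p A B : R)
    (a b : I -> R) : 1 < p -> 0 < A -> 0 < B ->
  (forall i, 0 <= a i) -> (forall i, 0 <= b i) ->
  \sum_(i <- s) a i `^ p <= A `^ p -> \sum_(i <- s) b i `^ p <= B `^ p ->
  \sum_(i <- s) a i `^ (p - 1) * b i <= A `^ (p - 1) * B.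
Proof.
move=> p1 A0 B0 a0 b0 sa sb.
have p0 : 0 < p by lra.
pose q := p / (p - 1).
have q0 : 0 < q by rewrite divr_gt0// subr_gt0.
have pq : q^-1 + p^-1 = 1 by rewrite /q; field; rewrite !gt_eqF// subr_gt0.
rewrite -[leRHS]mul1r -ler_pdivrMr ?mulr_gt0 ?powR_gt0// mulr_suml.
have le1 :
    \sum_(i <- s) ((a i `^ p / A `^ p) / q + (b i `^ p / B `^ p) / p) <= 1.
  rewrite big_split/= -!mulr_suml -pq; apply: lerD.
    by rewrite ler_piMl ?invr_ge0 ?(ltW q0)// ler_pdivrMr ?powR_gt0// mul1r.
  by rewrite ler_piMl ?invr_ge0 ?(ltW p0)// ler_pdivrMr ?powR_gt0// mul1r.
apply: le_trans le1; apply: ler_sum => i _.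
have := @conjugate_powR R ((a i / A) `^ (p - 1)) (b i / B) q p.
rewrite powR_ge0 divr_ge0 ?(ltW B0)// => /(_ isT isT q0 p0 pq).
rewrite -powRrM; have -> : (p - 1) * q = p.
  by rewrite /q; field; rewrite gt_eqF// subr_gt0.
rewrite !powR_div//.
suff -> : a i `^ (p - 1) / A `^ (p - 1) * (b i / B) =
  a i `^ (p - 1) * b i / (A `^ (p - 1) * B) by [].
by field; rewrite !gt_eqF ?powR_gt0.
Qed.

(** Continuity of [powR ^~ p] from the right at [u], solved for the increment:
    [d] is the [p]-th root of [u `^ p + e] minus [u]. *)
Lemma powR_upper_continuous (R : realType) (p u e : R) : 0 < p -> 0 <= u ->
  0 < e -> exists2 d : R, 0 < d & (u + d) `^ p = u `^ p + e.
Proof.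
move=> p0 u0 e0; exists ((u `^ p + e) `^ p^-1 - u).
  rewrite subr_gt0; have {1}-> : u = (u `^ p) `^ p^-1.
    by rewrite -powRrM mulfV ?gt_eqF// powRr1.
  by rewrite gt0_ltr_powR ?invr_gt0// ?nnegrE ?addr_ge0 ?powR_ge0 ?ltrDl// ltW.
by rewrite subrKC -powRrM mulVf ?gt_eqF// powRr1// addr_ge0 ?powR_ge0// ltW.
Qed.

Lemma ler_powR_cancel (R : realType) (p x y : R) : 0 < p -> 0 <= x -> 0 <= y ->
  x `^ p <= y `^ p -> x <= y.
Proof.
move=> p0 x0 y0; rewrite !leNgt; apply: contraNN => yx.
by rewrite gt0_ltr_powR// nnegrE.
Qed.

(** * Moduli and limits in a scalar field *)

Section ScalarFieldTheory.
Variables (R : realType) (K : scalarField R).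
Implicit Types (z w : K) (u : nat -> K).

Lemma modulus_of_real (a : R) : 0 <= a -> modulus (of_real K a) = a.
Proof.
move=> a0; apply: (fmorph_inj (of_real K)); rewrite modulusE ger0_norm//.
by rewrite -(rmorph0 (of_real K)) ler_of_real.
Qed.

Lemma modulusN z : modulus (- z) = modulus z.
Proof. by apply: (fmorph_inj (of_real K)); rewrite !modulusE normrN. Qed.

Lemma modulusV z : modulus z^-1 = (modulus z)^-1.
Proof.
by apply: (fmorph_inj (of_real K)); rewrite fmorphV !modulusE normfV.
Qed.

Lemma modulus_sum (I : Type) (s : seq I) (F : I -> K) :
  modulus (\sum_(i <- s) F i) <= \sum_(i <- s) modulus (F i).
Proof.
elim/big_ind2: _ => //; first by rewrite modulus0.
by move=> z a w b za wb; exact: le_trans (modulusD _ _) (lerD za wb).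
Qed.

(** The topology of [K] is defined with radii in [K]. Real radii suffice, since
    a positive element of [K] equals its norm, hence is a real scalar. *)
Lemma cvgn_modulusP u (l : K) : u n @[n --> \oo] --> l <->
  forall e : R, 0 < e -> \forall n \near \oo, modulus (l - u n) < e.
Proof.
have lt_of_real (a b : R) : (of_real K a < of_real K b) = (a < b).
  exact: (leW_mono (@ler_of_real _ K)).
have [cvg_lt lt_cvg] := @cvgrPdist_lt K K nat \oo _ u l.
split=> [/cvg_lt ul e e0|ul].
  have eK : 0 < of_real K e by rewrite -(rmorph0 (of_real K)) lt_of_real.
  by apply: filterS (ul _ eK) => n; rewrite -modulusE lt_of_real.
apply: lt_cvg => e e0; have eE : of_real K (modulus e) = e.
  by rewrite modulusE gtr0_norm.
have me0 : 0 < modulus e by rewrite -lt_of_real eE rmorph0.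
by apply: filterS (ul _ me0) => n; rewrite -lt_of_real eE modulusE.
Qed.

Lemma modulus_limB_le u (l c : K) (b : R) m : u n @[n --> \oo] --> l ->
  (forall n, (m <= n)%N -> modulus (u n - c) <= b) -> modulus (l - c) <= b.
Proof.
move=> ul ub; apply/ler_addgt0Pr => e e0.
have [k _ kP] := (cvgn_modulusP _ _).1 ul _ e0.
have -> : l - c = (u (maxn m k) - c) + (l - u (maxn m k)) by ring.
apply: le_trans (modulusD _ _) (lerD _ (ltW _)).
  by apply: ub; rewrite leq_maxl.
by apply: kP; rewrite /= leq_maxr.
Qed.

(** Completeness of [K], in the form that the convergence of a series of
    functionals at each vector calls for. *)
Definition absolutely_complete :=
  forall u : nat -> K,
    cvgn (series (fun n => modulus (u n))) -> cvgn (series u).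

End ScalarFieldTheory.

Lemma real_absolutely_complete (R : realType) :
  absolutely_complete (real_field R).
Proof. by move=> u; exact: (@normed_cvg R R u). Qed.

(** The moduli of the real and imaginary parts are at most the modulus, so that
    both real series converge absolutely. *)
Lemma complex_absolutely_complete (R : realType) :
  absolutely_complete (complex_field R).
Proof.
move=> u cu.
have cvg_part (part : R[i] -> R) :
    (forall z, `|part z| <= ComplexField.Normc.normc z) ->
    cvgn (series (part \o u)).
  move=> part_le; apply: (@normed_cvg R R).
  apply: series_le_cvg cu => n /=.
  - exact: normr_ge0.
  - exact: (@modulus_ge0 R (complex_field R)).
  - exact: part_le.
have ReC : forall z : R[i], `|complex.Re z| <= ComplexField.Normc.normc z.
  move=> [a b] /=; rewrite -sqrtr_sqr ler_sqrt ?addr_ge0 ?sqr_ge0//.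
  by rewrite lerDl sqr_ge0.
have ImC : forall z : R[i], `|complex.Im z| <= ComplexField.Normc.normc z.
  move=> [a b] /=; rewrite -sqrtr_sqr ler_sqrt ?addr_ge0 ?sqr_ge0//.
  by rewrite lerDr sqr_ge0.
have normc_le (z : R[i]) :
    ComplexField.Normc.normc z <= `|complex.Re z| + `|complex.Im z|.
  case: z => a b /=.
  rewrite -(ger0_norm (addr_ge0 (normr_ge0 a) (normr_ge0 b))).
  rewrite -sqrtr_sqr ler_sqrt ?sqr_ge0// sqrrD !real_normK ?num_real//.
  by rewrite lerD2r lerDl mulrn_wge0// mulr_ge0.
have normcB_le (z w : R[i]) : ComplexField.Normc.normc (z - w) <=
    `|complex.Re z - complex.Re w| + `|complex.Im z - complex.Im w|.
  by case: z w => [? ?] [? ?]; exact: normc_le.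
have Re_series n :
    complex.Re (series u n : R[i]) = series ((@complex.Re R) \o u) n.
  by apply: big_morph => [[? ?] [? ?]|].
have Im_series n :
    complex.Im (series u n : R[i]) = series ((@complex.Im R) \o u) n.
  by apply: big_morph => [[? ?] [? ?]|].
have := cvg_part _ ReC; have := cvg_part _ ImC.
set b := limn (series ((@complex.Im R) \o u)).
set a := limn (series ((@complex.Re R) \o u)).
move=> /cvgrPdist_lt cb /cvgrPdist_lt ca.
apply/cvg_ex; exists (Complex a b).
apply/(@cvgn_modulusP R (complex_field R)) => e e0.
have e20 : 0 < e / 2 by rewrite divr_gt0.
apply: filterS2 (ca _ e20) (cb _ e20) => n an bn.
apply: le_lt_trans (normcB_le (Complex a b) (series u n)) _.
by rewrite [e]splitr Re_series Im_series; exact: ltrD an bn.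
Qed.

(** * Boundedness of weakly null sequences *)

Section Functionals.
Variables (R : realType) (K : scalarField R) (V : lmodType K) (N : seminorm V).
Implicit Types (f g : V -> K) (x : nat -> V).

(** The functional is a bare function, since the functionals below are built by
    recursion, limits and choice; it is bundled only to be tested against a
    weakly null sequence. *)
Definition dual_ball f := linear f /\ forall v, modulus (f v) <= N v.

Lemma seminorm0 : N 0 = 0.
Proof. by rewrite -(scale0r 0) seminormZ modulus0 mul0r. Qed.

Lemma seminorm_ge0 (v : V) : 0 <= N v.
Proof.
have : N 0 <= N v + N (- v) by rewrite -(subrr v); exact: seminormD.
have NN : N (- v) = N v.
  have -> : - v = (-1) *: v by rewrite scaleN1r.
  rewrite seminormZ.
  rewrite (_ : modulus (-1) = 1) ?mul1r// modulusN -(rmorph1 (of_real K)).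
  by rewrite modulus_of_real.
by rewrite seminorm0 NN; lra.
Qed.

Lemma weakly_null_bounded_functional x f (c : R) : weakly_null N x ->
  linear f -> (forall v, modulus (f v) <= c * N v) ->
  forall e : R, 0 < e -> \forall j \near \oo, modulus (f (x j)) < e.
Proof.
move=> xw lf bf e e0.
pose F := HB.pack_for {linear V -> K} f (GRing.isLinear.Build K V K _ f lf).
have cf : continuous_functional N F.
  move=> v d d0; exists (d / (`|c| + 1)) => [|y yv].
    by rewrite divr_gt0// ltr_pwDr.
  rewrite -linearB; apply: le_lt_trans (bf _) _.
  apply: (@le_lt_trans _ _ ((`|c| + 1) * N (y - v))).
    by rewrite ler_wpM2r ?seminorm_ge0// (le_trans (ler_norm c))// lerDl.
  by rewrite mulrC -ltr_pdivlMr// ltr_pwDr.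
have := (cvgn_modulusP _ _).1 (xw F cf) e e0.
by apply: filterS => j; rewrite sub0r modulusN.
Qed.

(** Adding [9^-1 ^+ m * g m] only when the current value at [z m] is small makes
    the new value at [z m] large in either case, whatever the earlier terms
    contribute there. *)
Fixpoint gliding_sum (g : nat -> V -> K) (z : nat -> V) n : V -> K :=
  if n is m.+1 then
    if 9^-1 ^+ m * N (z m) / 4 <= modulus (gliding_sum g z m (z m))
    then gliding_sum g z m
    else fun v => gliding_sum g z m v + of_real K (9^-1 ^+ m) * g m v
  else fun=> 0.

Section GlidingSum.
Variables (g : nat -> V -> K) (z : nat -> V).
Hypothesis g_ball : forall n, dual_ball (g n).
Hypothesis g_norming : forall n, N (z n) <= 2 * modulus (g n (z n)).
Let F := gliding_sum g z.

Lemma gliding_sum_linear n : linear (F n).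
Proof.
elim: n => [|n ih] a u v; first by rewrite /F/= scaler0 addr0.
rewrite /F /=; case: ifP => _; first exact: ih.
rewrite -/F ih (g_ball n).1.
by rewrite /GRing.scale /=; ring.
Qed.

Lemma modulus_gliding_step n v :
  modulus (F n.+1 v - F n v) <= 9^-1 ^+ n * N v.
Proof.
have c0 : 0 <= 9^-1 ^+ n :> R by rewrite exprn_ge0.
rewrite /F /=; case: ifP => _.
  by rewrite subrr modulus0 mulr_ge0 ?seminorm_ge0.
rewrite addrC addKr modulusM modulus_of_real//.
by rewrite ler_wpM2l// (g_ball n).2.
Qed.

(** The bound is the tail [9^-1 ^+ n * (1 + 9^-1 + ...)] of the geometric
    series of the steps. *)
Lemma modulus_gliding_diff n k v :
  modulus (F (n + k)%N v - F n v) <= 9^-1 ^+ n * N v * (9 / 8).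
Proof.
apply: (@le_trans _ _ ((9^-1 ^+ n - 9^-1 ^+ (n + k)) * N v * (9 / 8))).
  (* the bound by the finite geometric sum is the one that telescopes *)
  elim: k => [|k ih]; first by rewrite addn0 !subrr modulus0 !mul0r.
  have -> : F (n + k.+1)%N v - F n v =
      (F (n + k).+1 v - F (n + k)%N v) + (F (n + k)%N v - F n v).
    by rewrite addnS; ring.
  apply: le_trans (modulusD _ _) _.
  apply: le_trans (lerD (modulus_gliding_step _ _) ih) _.
  rewrite addnS exprS le_eqVlt; apply/orP; left; apply/eqP.
  by field.
rewrite -!mulrA ler_wpM2r ?mulr_ge0 ?seminorm_ge0//.
by rewrite gerBl exprn_ge0.
Qed.

(** If the sum is left unchanged this is the test that decided so; otherwise
    [9^-1 ^+ n * g n] is at least [9^-1 ^+ n * N (z n) / 2] at [z n], and the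
    previous value takes away less than half of it. *)
Lemma gliding_sum_large n :
  9^-1 ^+ n * N (z n) / 4 <= modulus (F n.+1 (z n)).
Proof.
have c0 : 0 <= 9^-1 ^+ n :> R by rewrite exprn_ge0.
rewrite /F /=; case: ifP => // /negbT; rewrite -ltNge => Fz.
have := modulusD (F n (z n) + of_real K (9^-1 ^+ n) * g n (z n)) (- F n (z n)).
rewrite addrAC subrr add0r modulusM modulus_of_real// modulusN.
have : 9^-1 ^+ n * N (z n) <= 9^-1 ^+ n * (2 * modulus (g n (z n))).
  by rewrite ler_wpM2l.
rewrite -/F; move: Fz; rewrite -/F; lra.
Qed.

Hypothesis Kc : absolutely_complete K.

Lemma cvg_gliding_sum v : cvgn (fun n => F n v).
Proof.
have -> : (fun n => F n v) = series (fun n => F n.+1 v - F n v).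
  by apply/funext => n; rewrite /series/= telescope_sumr// subr0.
apply: Kc; apply: (series_le_cvg (v_ := geometric (N v) 9^-1)) => [n|n|n|].
- exact: modulus_ge0.
- by rewrite mulr_ge0 ?seminorm_ge0// exprn_ge0.
- by rewrite /= mulrC; exact: modulus_gliding_step.
- by apply: is_cvg_geometric_series; rewrite ger0_norm//; lra.
Qed.

Definition gliding_limit v := limn (fun n => F n v).

Lemma modulus_gliding_limitB n v :
  modulus (gliding_limit v - F n v) <= 9^-1 ^+ n * N v * (9 / 8).
Proof.
have cF : F k v @[k --> \oo] --> gliding_limit v := cvg_gliding_sum (v := v).
apply: (modulus_limB_le cF (m := n)) => k nk.
by rewrite -(subnKC nk) modulus_gliding_diff.
Qed.

Lemma gliding_limit_linear : linear gliding_limit.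
Proof.
move=> a u v; rewrite /gliding_limit.
have cF w : cvgn (fun n => F n w) by exact: cvg_gliding_sum.
have -> : (fun n => F n (a *: u + v)) =
    (fun=> a) \* (fun n => F n u) + (fun n => F n v).
  by apply/funext => n; rewrite gliding_sum_linear.
have caF : cvgn ((fun=> a) \* (fun n => F n u)).
  by apply: is_cvgMl_tmp; exact: cF.
rewrite limD//.
rewrite limM//; last exact: is_cvg_cst.
by rewrite lim_cst.
Qed.

End GlidingSum.

(** With [z m] a term of norm at least [8 * 9 ^+ m], the value of the limit
    functional at [z m] is at least [1/4] of [9^-1 ^+ m * N (z m)] by
    [gliding_sum_large], minus [9^-1 * 9 / 8 = 1/8] of it for the later steps,
    which leaves at least 1. *)
Lemma weakly_null_bounded x : absolutely_complete K ->
  (forall v, exists2 f, dual_ball f & N v <= 2 * modulus (f v)) ->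
  weakly_null N x -> exists2 M : R, 0 < M & forall j, N (x j) <= M.
Proof.
move=> Kc norming xw; apply: contrapT => unbounded.
(* [n <= j] keeps the selected terms arbitrarily far in the sequence *)
have large (n : nat) (b : R) : exists j, (n <= j)%N /\ b <= N (x j).
  apply: contrapT => no_j; apply: unbounded.
  exists (`|b| + 1 + \sum_(0 <= i < n) N (x i)) => [|j].
    by rewrite ltr_wpDr ?ltr_pwDr// sumr_ge0// => i _; exact: seminorm_ge0.
  have s0 m : 0 <= \sum_(0 <= i < m) N (x i).
    by rewrite sumr_ge0// => i _; exact: seminorm_ge0.
  have [nj|jn] := leqP n j.
    have : N (x j) < b.
      by rewrite ltNge; apply/negP => bj; apply: no_j; exists j.
    by have := ler_norm b; have := s0 n; lra.
  have : N (x j) <= \sum_(0 <= i < n) N (x i).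
    rewrite big_mkord (bigD1 (Ordinal jn))//= lerDl sumr_ge0// => i _.
    exact: seminorm_ge0.
  by have := normr_ge0 b; lra.
have [s sP] := choice (fun n => large n (8 * 9 ^+ n)).
have norming_xs n : exists f, dual_ball f /\
    N (x (s n)) <= 2 * modulus (f (x (s n))).
  by have [f fb fx] := norming (x (s n)); exists f.
have [g gP] := choice norming_xs.
have gb n : dual_ball (g n) := (gP n).1.
pose z n := x (s n); have gn n : N (z n) <= 2 * modulus (g n (z n)) := (gP n).2.
pose f := gliding_limit g z.
have f_le v : modulus (f v) <= 9 / 8 * N v.
  have := modulus_gliding_limitB z gb Kc 0 v.
  by rewrite /= subr0 expr0 mul1r mulrC.
have [m _ mP] := weakly_null_bounded_functional xw
  (gliding_limit_linear z gb Kc) f_le ltr01.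
have := mP (s m) (sP m).1; apply/negP; rewrite -leNgt.
have := modulus_gliding_limitB z gb Kc m.+1 (z m).
have := gliding_sum_large gn m.
have := modulusD (gliding_limit g z (z m))
  (- (gliding_limit g z (z m) - gliding_sum g z m.+1 (z m))).
rewrite modulusN opprB addrC subrK -/(z m) exprS.
have : 9^-1 ^+ m * (8 * 9 ^+ m) <= 9^-1 ^+ m * N (z m).
  by rewrite ler_wpM2l ?exprn_ge0//; exact: (sP m).2.
rewrite mulrCA -exprMn mulVf// expr1n.
lra.
Qed.
End Functionals.

(** * Seminorms given by the power sums of a sequence of functionals *)

Section LpSeminorm.
Variables (R : realType) (K : scalarField R) (V : lmodType K) (N : seminorm V).
Variables (p : R) (T : nat -> V -> K).
Hypothesis p_gt1 : 1 < p.
Hypothesis T_linear : forall n, linear (T n).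
Hypothesis T_le : forall v m,
  \sum_(0 <= n < m) modulus (T n v) `^ p <= N v `^ p.
Hypothesis T_ge : forall v b,
  (forall m, \sum_(0 <= n < m) modulus (T n v) `^ p <= b) -> N v `^ p <= b.

Let p_gt0 : 0 < p. Proof. exact: lt_trans p_gt1. Qed.

Lemma powR_seminorm_approx v (b : R) : b < N v `^ p ->
  exists m, b < \sum_(0 <= n < m) modulus (T n v) `^ p.
Proof.
move=> bN; apply: contrapT => no_m; move: bN; apply/negP; rewrite -leNgt.
by apply: T_ge => m; rewrite leNgt; apply/negP => bm; apply: no_m; exists m.
Qed.

Lemma modulus_coordinate_le n v : modulus (T n v) <= N v.
Proof.
apply: (ler_powR_cancel p_gt0); rewrite ?modulus_ge0 ?seminorm_ge0//.
apply: le_trans (T_le v n.+1); rewrite big_nat_recr//= lerDr.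
by rewrite sumr_ge0// => i _; exact: powR_ge0.
Qed.

(** The functional is the classical extremal one,
    [w |-> A `^ (1 - p) * \sum_n |T n v| `^ p / T n v * T n w], truncated to
    finitely many coordinates so that linearity and the value at [v] are
    identities between finite sums; the truncation costs the factor 2. *)
Lemma norming_functional v :
  exists2 f : V -> K, dual_ball N f & N v <= 2 * modulus (f v).
Proof.
have [Nv0|Nv0] := eqVneq (N v) 0.
  exists (fun=> 0); last by rewrite Nv0 modulus0 mulr0.
  split=> [a u w|w]; last by rewrite modulus0 seminorm_ge0.
  by rewrite scaler0 addr0.
have Nv_gt0 : 0 < N v by rewrite lt_def Nv0 seminorm_ge0.
have [m Sm] : exists m, (N v / 2) `^ p < \sum_(0 <= n < m) modulus (T n v) `^ p.
  by apply: powR_seminorm_approx; rewrite gt0_ltr_powR ?nnegrE//; lra.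
set S := \sum_(0 <= n < m) _ in Sm.
have S0 : 0 < S by apply: le_lt_trans Sm; exact: powR_ge0.
pose A := S `^ p^-1.
have A0 : 0 < A by exact: powR_gt0.
have Ap : A `^ p = S by rewrite -powRrM mulVf ?gt_eqF// powRr1// ltW.
have NA : N v / 2 <= A.
  apply: (ler_powR_cancel p_gt0); [lra|exact: ltW|by rewrite Ap ltW].
pose a n := modulus (T n v).
(* when [T n v = 0], the convention [0^-1 = 0] gives the right weight 0 *)
pose c n : K := of_real K (a n `^ p) / T n v.
have c_le n : modulus (c n) <= a n `^ (p - 1).
  rewrite /c modulusM modulusV modulus_of_real ?powR_ge0// -/(a n).
  rewrite -mulr_powRB1 ?modulus_ge0// mulrAC.
  have [->|an0] := eqVneq (a n) 0; first by rewrite mul0r mul0r powR_ge0.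
  by rewrite mulfV// mul1r.
have cT n : c n * T n v = of_real K (a n `^ p).
  rewrite /c; have [T0|T0] := eqVneq (T n v) 0; last by rewrite mulfVK.
  by rewrite /a T0 modulus0 powR0 ?gt_eqF// rmorph0 mulr0.
have AK : 0 < A `^ (p - 1) by exact: powR_gt0.
pose f w := of_real K (A `^ (p - 1))^-1 * \sum_(0 <= n < m) c n * T n w.
have fv : modulus (f v) = A.
  rewrite /f (eq_bigr (fun n => of_real K (a n `^ p))) => [|n _].
    2: exact: cT.
  rewrite -rmorph_sum -rmorphM modulus_of_real/=.
    rewrite -/S -Ap -(mulr_powRB1 (ltW A0) p_gt0) mulrCA mulVf ?gt_eqF//.
    by rewrite mulr1.
  by rewrite mulr_ge0 ?invr_ge0 ?(ltW AK) ?(ltW S0).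
exists f; last by rewrite fv; lra.
split=> [b u w|w].
  rewrite /f (eq_bigr (fun n => b * (c n * T n u) + c n * T n w)) => [|n _].
    by rewrite big_split/= -mulr_sumr mulrDr /GRing.scale/=; ring.
  by rewrite T_linear /GRing.scale/=; ring.
(* [hoelder_sum] asks for a positive bound, and [N w] may vanish *)
apply/ler_addgt0Pr => e e0.
have Ne : 0 < N w + e by rewrite ltr_wpDl ?seminorm_ge0.
rewrite /f modulusM modulus_of_real ?invr_ge0 ?(ltW AK)// mulrC ler_pdivrMr//.
apply: le_trans (modulus_sum _ _) _.
rewrite mulrC; apply: le_trans (hoelder_sum (s := index_iota 0 m)
  (a := a) (b := fun n => modulus (T n w)) p_gt1 A0 Ne _ _ _ _).
- by apply: ler_sum => n _; rewrite modulusM ler_wpM2r// modulus_ge0.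
- by move=> n; exact: modulus_ge0.
- by move=> n; exact: modulus_ge0.
- by rewrite Ap.
- apply: le_trans (T_le w m) _; apply: ge0_ler_powR.
  + exact: ltW.
  + by rewrite nnegrE seminorm_ge0.
  + by rewrite nnegrE ltW.
  + by rewrite lerDl ltW.
Qed.

Section NearOrthogonality.
Variables (x : nat -> V) (M : R).
Hypothesis M_gt0 : 0 < M.
Hypothesis x_le : forall j, N (x j) <= M.
Hypothesis x_coord : forall n (e : R), 0 < e ->
  \forall j \near \oo, modulus (T n (x j)) < e.

Lemma near_head_powR_le v m (e : R) : 0 < e -> \forall j \near \oo,
  \sum_(0 <= n < m) (modulus (T n v) + modulus (T n (x j))) `^ p <=
  \sum_(0 <= n < m) modulus (T n v) `^ p + e.
Proof.
elim: m e => [|m ih] e e0.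
  by near=> j; rewrite !big_nil add0r ltW.
have e20 : 0 < e / 2 by rewrite divr_gt0.
have [d d0 dE] := powR_upper_continuous p_gt0 (modulus_ge0 (T m v)) e20.
apply: filterS2 (ih _ e20) (x_coord m d0) => j head_le xd.
rewrite !big_nat_recr//=.
have : (modulus (T m v) + modulus (T m (x j))) `^ p <=
    modulus (T m v) `^ p + e / 2.
  rewrite -dE; apply: ge0_ler_powR.
  - exact: ltW.
  - by rewrite nnegrE addr_ge0 ?modulus_ge0.
  - by rewrite nnegrE addr_ge0 ?modulus_ge0// ltW.
  - by rewrite lerD2l ltW.
by lra.
Unshelve. all: by end_near. Qed.

(** Cut at a rank [m] beyond which [v] has norm at most [d]. Before [m],
    finitely many coordinates occur, and those of [x j] tend to 0; after [m],
    Minkowski's inequality bounds the norm by [d + M], and [d] is chosen so that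
    [(d + M) `^ p] exceeds [M `^ p] by [e / 2]. *)
Lemma near_powR_seminormD_le v (e : R) : 0 < e -> \forall j \near \oo,
  N (v + x j) `^ p <= N v `^ p + M `^ p + e.
Proof.
move=> e0; have e20 : 0 < e / 2 by rewrite divr_gt0.
have [d d0 dE] := powR_upper_continuous p_gt0 (ltW M_gt0) e20.
have [m mv] : exists m,
    N v `^ p - d `^ p < \sum_(0 <= n < m) modulus (T n v) `^ p.
  by apply: powR_seminorm_approx; rewrite ltrBlDr ltrDl powR_gt0.
apply: filterS (near_head_powR_le v m e20) => j head_le.
have T_sumle k : \sum_(0 <= n < k) modulus (T n (v + x j)) `^ p <=
    \sum_(0 <= n < k) (modulus (T n v) + modulus (T n (x j))) `^ p.
  apply: ler_sum => n _; apply: ge0_ler_powR.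
  - exact: ltW.
  - by rewrite nnegrE modulus_ge0.
  - by rewrite nnegrE addr_ge0 ?modulus_ge0.
  - have := T_linear n 1 v (x j); rewrite !scale1r => ->.
    exact: modulusD.
apply: T_ge => k; apply: le_trans (T_sumle k) _.
have split_sum (F : nat -> R) : \sum_(0 <= n < m + k) F n =
    \sum_(0 <= n < m) F n + \sum_(m <= n < m + k) F n.
  by rewrite -big_cat_nat//= leq_addr.
have tail_le : \sum_(m <= n < m + k)
    (modulus (T n v) + modulus (T n (x j))) `^ p <= (d + M) `^ p.
  apply: minkowski_sum; rewrite ?(ltW p_gt1)//.
  - by move=> n; exact: modulus_ge0.
  - by move=> n; exact: modulus_ge0.
  - by have := T_le v (m + k); rewrite split_sum; lra.
  - apply: (@le_trans _ _ (N (x j) `^ p)).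
      apply: le_trans (T_le (x j) (m + k)); rewrite split_sum lerDr.
      by rewrite sumr_ge0// => n _; exact: powR_ge0.
    by apply: ge0_ler_powR;
      rewrite ?nnegrE ?seminorm_ge0 ?(ltW p_gt0) ?(ltW M_gt0).
have : \sum_(0 <= n < k) (modulus (T n v) + modulus (T n (x j))) `^ p <=
    \sum_(0 <= n < m + k) (modulus (T n v) + modulus (T n (x j))) `^ p.
  rewrite [leRHS](big_cat_nat (n := k))//= ?leq_addl// lerDl.
  by rewrite sumr_ge0// => n _; exact: powR_ge0.
have := T_le v m.
rewrite split_sum; move: tail_le; rewrite (addrC d M) dE; lra.
Qed.
End NearOrthogonality.

Theorem lp_seminorm_Banach_Saks : absolutely_complete K ->
  Banach_Saks_type N p.
Proof.
move=> Kc x xw.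
have [M M0 xM] := weakly_null_bounded Kc norming_functional xw.
have x_coord n (e : R) : 0 < e -> \forall j \near \oo, modulus (T n (x j)) < e.
  apply: (@weakly_null_bounded_functional _ _ _ N x (T n) 1) => // v.
  by rewrite mul1r modulus_coordinate_le.
pose B := M `^ p + 1.
have B0 : 0 < B by rewrite ltr_wpDl ?powR_ge0.
have next (st : nat * V) : exists j,
    (st.1 < j)%N /\ N (st.2 + x j) `^ p <= N st.2 `^ p + B.
  have [k _ kP] := near_powR_seminormD_le M0 xM x_coord st.2 ltr01.
  exists (maxn st.1.+1 k); split; first by rewrite leq_maxl.
  by rewrite /B addrA; apply: kP; rewrite /= leq_maxr.
have [h hP] := choice next.
(* the state is the index of the last selected term and the sum so far *)
pose st n : nat * V := iter n (fun s => (h s, s.2 + x (h s))) (0%N, 0).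
pose s n := h (st n).
have stS n : (st n).2 = \sum_(0 <= k < n) x (s k).
  by elim: n => [|n ih]; rewrite ?big_nil// big_nat_recr//= -ih.
have sum_le n : N (\sum_(0 <= k < n) x (s k)) `^ p <= n%:R * B.
  elim: n => [|n ih].
    by rewrite big_nil seminorm0 powR0 ?gt_eqF// mul0r.
  rewrite big_nat_recr//= -stS; apply: le_trans (hP (st n)).2 _.
  by rewrite stS mulrSr mulrDl mul1r lerD2r.
exists s; first by apply: (homo_ltn ltn_trans) => n; exact: (hP (st n.+1)).1.
(* [B + 1] rather than [B], for a strict inequality *)
exists ((B + 1) `^ p^-1) => [|n]; first by rewrite powR_gt0// addr_gt0.
have B1 : 0 <= B + 1 by rewrite addr_ge0 ?ltW.
rewrite -powRM//.
have NE (t : R) : 0 <= t -> t = (t `^ p) `^ p^-1.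
  by move=> t0; rewrite -powRrM mulfV ?gt_eqF// powRr1.
rewrite (NE (N _)) ?seminorm_ge0// gt0_ltr_powR ?invr_gt0//.
- by rewrite nnegrE powR_ge0.
- by rewrite nnegrE mulr_ge0.
- apply: le_lt_trans (sum_le n.+1) _.
  by rewrite mulrC ltr_pM2r// ltrDl.
Qed.

End LpSeminorm.

(** * The Taylor sequence space *)

Section TaylorSpace.
Variables (R : realType) (K : scalarField R) (r p : R).
Hypothesis p_gt1 : 1 < p.
Let p_gt0 : 0 < p. Proof. exact: lt_trans p_gt1. Qed.
Local Notation X := (taylor_space K r (ltW p_gt1)).
Let N := taylor_norm K r (ltW p_gt1).
Implicit Types v : X.

Lemma taylor_transform_linear n :
  linear (fun v : X => taylor_transform r (val v) n).
Proof.
move=> a u v; have [cu _] := in_taylor_space_val u.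
have [cv _] := in_taylor_space_val v.
have -> : val (a *: u + v) = a *: (val u : nat -> K) + (val v : nat -> K) by [].
rewrite taylor_transformD ?taylor_transformZ//.
exact: is_cvg_taylor_partialZ.
Qed.

Lemma taylor_norm_powR v : (N v `^ p)%:E = taylor_power_sum r p (val v).
Proof.
have [_ v_fin] := in_taylor_space_val v.
have v_ge0 : (0 <= taylor_power_sum r p (val v))%E.
  by apply: nneseries_ge0 => n _ _; rewrite lee_fin powR_ge0.
rewrite -powRrM mulVf ?gt_eqF// powRr1 ?fine_ge0// fineK//.
by rewrite ge0_fin_numE.
Qed.

Lemma taylor_partial_sum_le v m :
  \sum_(0 <= n < m) modulus (taylor_transform r (val v) n) `^ p <= N v `^ p.
Proof.
rewrite -lee_fin taylor_norm_powR -sumEFin.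
by apply: nneseries_lim_ge => n _ _; rewrite lee_fin powR_ge0.
Qed.

Lemma taylor_norm_powR_le v (b : R) :
  (forall m,
    \sum_(0 <= n < m) modulus (taylor_transform r (val v) n) `^ p <= b) ->
  N v `^ p <= b.
Proof.
move=> vb; rewrite -lee_fin taylor_norm_powR; apply: lime_le.
  by apply: is_cvg_nneseries => n _ _; rewrite lee_fin powR_ge0.
by apply: nearW => m; rewrite sumEFin lee_fin.
Qed.

Lemma taylor_space_Banach_Saks : absolutely_complete K -> Banach_Saks_type N p.
Proof.
move=> Kc; apply: (lp_seminorm_Banach_Saks p_gt1) Kc.
- exact: taylor_transform_linear.
- exact: taylor_partial_sum_le.
- exact: taylor_norm_powR_le.
Qed.
End TaylorSpace.

Theorem theorem3p2 (R : realType) (r p : R)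
    (r_gt0 : 0 < r) (r_lt1 : r < 1) (p_gt1 : 1 < p) :
  Banach_Saks_type (taylor_norm (real_field R) r (ltW p_gt1)) p /\
  Banach_Saks_type (taylor_norm (complex_field R) r (ltW p_gt1)) p.
Proof.
split; apply: taylor_space_Banach_Saks.
- exact: real_absolutely_complete.
- exact: complex_absolutely_complete.
Qed.
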